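(* Let $H$ be a graph. The corona $H\circ K_1$ has two disjoint maximum independent sets if and only if $H$ is bipartite.
   Context: Graphs are finite, simple, undirected, with non-empty vertex sets. $H\circ K_1$ is the graph obtained from $H$ by attaching, for each vertex $u$ of $H$, a new vertex adjacent only to $u$. An independent set is a set of pairwise non-adjacent vertices; a maximum independent set is one of largest size. *)

(* Defs.v *)
From mathcomp Require Import all_boot.

Set Implicit Arguments.
Unset Strict Implicit.
Unset Printing Implicit Defensive.

Record graph := Graph {
  vertex :> finType;
  adj : rel vertex;
  adj_sym : symmetric adj;
  adj_irr : irreflexive adj;
  vertex_gt0 : 0 < #|vertex|
}.

Definition independent (G : graph) (S : {set G}) : Prop :=
  forall x y, x \in S -> y \in S -> ~~ adj x y.

Definition maximum_independent (G : graph) (S : {set G}) : Prop :=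
  independent S /\ forall S' : {set G}, independent S' -> #|S'| <= #|S|.

(* The parts may be empty, so edgeless graphs (K_1 included) are bipartite. *)
Definition bipartite (G : graph) : Prop :=
  exists A B : {set G},
    [/\ A :|: B = [set: G], [disjoint A & B], independent A & independent B].

Section Corona.
Variable H : graph.

(* [inl u] is the vertex u of H, [inr u] is the new vertex attached to u. *)
Definition corona_adj (x y : H + H) : bool :=
  match x, y with
  | inl u, inl v => adj u v
  | inl u, inr v | inr u, inl v => u == v
  | inr _, inr _ => false
  end.

Lemma corona_adj_sym : symmetric corona_adj.
Proof. by case=> u [] v //=; rewrite ?(adj_sym u v) // eq_sym. Qed.

Lemma corona_adj_irr : irreflexive corona_adj.
Proof. by case=> u //=; rewrite adj_irr. Qed.

Lemma corona_vertex_gt0 : 0 < #|{: H + H}|.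
Proof. by rewrite card_sum addn_gt0 vertex_gt0. Qed.

Definition corona : graph :=
  Graph corona_adj_sym corona_adj_irr corona_vertex_gt0.

End Corona.

(* Main.v *)
Require Import Defs.
From mathcomp Require Import all_boot.

Set Implicit Arguments.
Unset Strict Implicit.
Unset Printing Implicit Defensive.

(** Projecting each pendant vertex of the corona to its support is injective on
    independent sets, so the independence number is [#|H|] (attained by the
    pendants), and a maximum independent set contains exactly one of [u] and its
    pendant for each vertex [u] of [H]. Thus maximum independent sets of the
    corona correspond to independent sets of [H], and two of them are disjoint
    iff the corresponding sets of [H] are complementary. *)

Definition corona_base (H : graph) (x : corona H) : H :=
  match x with inl u | inr u => u end.

(** Distinct vertices with the same base [u] are [inl u] and [inr u], which are adjacent. *)
Lemma independent_base_inj (H : graph) (S : {set corona H}) :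
  independent S -> {in S &, injective (@corona_base H)}.
Proof.
move=> indS [] u [] v uS vS /= euv; rewrite euv // in uS *.
all: by have := indS _ _ uS vS; rewrite /= eqxx.
Qed.

Lemma corona_independent_card (H : graph) (S : {set corona H}) :
  independent S -> #|S| <= #|H|.
Proof.
by move=> indS; rewrite -(card_in_imset (independent_base_inj indS)) max_card.
Qed.

Definition corona_lift (H : graph) (A : {set H}) : {set corona H} :=
  [set x : H + H | match x with inl u => u \in A | inr u => u \notin A end].

Lemma corona_lift_independent (H : graph) (A : {set H}) :
  independent A -> independent (corona_lift A).
Proof.
move=> indA [] u [] v; rewrite !inE //= => uA vA; first exact: indA.
all: by apply: contraTneq uA => ->; rewrite ?vA.
Qed.

(** [corona_base] maps the lift onto [H], whatever [A] is. *)
Lemma corona_lift_card (H : graph) (A : {set H}) : #|H| <= #|corona_lift A|.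
Proof.
rewrite -cardsT; apply: leq_trans (leq_imset_card (@corona_base H) _).
apply/subset_leq_card/subsetP=> u _; apply/imsetP.
by have [uA|uA] := boolP (u \in A); [exists (inl u)|exists (inr u)];
  rewrite ?inE.
Qed.

Lemma corona_lift_maximum (H : graph) (A : {set H}) :
  independent A -> maximum_independent (corona_lift A).
Proof.
move=> indA; split; first exact: corona_lift_independent.
move=> S' /corona_independent_card leS'.
exact: leq_trans leS' (corona_lift_card A).
Qed.

Lemma maximum_independent_cover (H : graph) (S : {set corona H}) (u : H) :
  maximum_independent S -> (inl u \in S) || (inr u \in S).
Proof.
case=> indS maxS.
(* The lift of [set0] consists of all pendants, so maximality forces [S] to have at least [#|H|]
   elements. *)
have ind0 : independent (set0 : {set H}) by move=> x y; rewrite inE.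
have /eqP eqT : (@corona_base H) @: S == [set: H].
  rewrite eqEcard subsetT cardsT (card_in_imset (independent_base_inj indS)).
  exact: leq_trans (corona_lift_card _) (maxS _ (corona_lift_independent ind0)).
have : u \in (@corona_base H) @: S by rewrite eqT inE.
by case/imsetP=> -[] v vS /= ->; rewrite vS ?orbT.
Qed.

Theorem theorem5p1 (H : graph) :
  (exists S1 S2 : {set corona H},
     [/\ maximum_independent S1, maximum_independent S2 & [disjoint S1 & S2]])
  <-> bipartite H.
Proof.
split=> [[S1 [S2 [max1 max2 dis]]]|[A [B [AUB dAB indA indB]]]].
  exists [set u | inl u \in S1], [set u | inl u \in S2]; split.
  - apply/setP=> u; rewrite !inE.
    have := maximum_independent_cover u max1.
    have := maximum_independent_cover u max2.
    (* If [inl u] is not in [S2], then [inr u] is; disjointness excludes it from [S1], which must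
       then contain [inl u]. *)
    case: (inl u \in S2) => /=; first by rewrite orbT.
    by move=> u2; rewrite (disjointFl dis u2) => ->.
  - apply/pred0P=> u /=; rewrite !inE.
    by apply/negP=> /andP[u1]; rewrite (disjointFr dis u1).
  - by move=> x y; rewrite !inE => x1 y1; have := max1.1 _ _ x1 y1.
  - by move=> x y; rewrite !inE => x2 y2; have := max2.1 _ _ x2 y2.
exists (corona_lift A), (corona_lift B); split; try exact: corona_lift_maximum.
apply/pred0P=> -[] u /=; rewrite !inE.
  by apply/negP=> /andP[uA]; rewrite (disjointFr dAB uA).
(* A common pendant [inr u] would put [u] outside both [A] and [B]. *)
by rewrite -negb_or -in_setU AUB inE.
Qed.
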